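(* Let $\mathcal H$ be a real Hilbert space, $I=\{1,\dots,m\}$ with $m\ge 1$, let $T_i\colon\mathcal H\to\mathcal H$, $i\in I$, be cutters, put $C_i:=\operatorname{Fix}T_i$ and $C:=\bigcap_{i\in I}C_i$, and let $Q\subset\mathcal H$ be closed and convex. Let $\{x_k\}_{k=0}^\infty$ be defined by $$x_0\in Q,\qquad x_{k+1}:=P_Q\Big(x_k+\alpha_k\sum_{i\in I_k}\lambda_{i,k}\,\beta_{i,k}(x_k)\big(T_i(x_k)-x_k\big)\Big),$$ where $\beta_{i,k}(x):=\dfrac{\frac{r_k}{\varphi_i(x)}+\|T_i(x)-x\|}{\|T_i(x)-x\|}$ if $T_i(x)\ne x$ and $\beta_{i,k}(x):=0$ otherwise, with $r_k\in(0,\infty)$, $\varphi_i\colon\mathcal H\to(0,\infty)$, $\alpha_k\in(0,2)$, $\emptyset\neq I_k\subset I$, $\lambda_{i,k}\in(0,1]$ and $\sum_{i\in I_k}\lambda_{i,k}=1$. Assume that: (i) $\operatorname{int}(C)\cap Q\neq\emptyset$. (ii) $r_k\to 0$ monotonically ($r_{k+1}\le r_k$ for all $k$), but with a rate slower than any geometric sequence, that is, for each $q\in(0,1)$ and $c>0$ there is $K\ge 0$ such that $r_k>cq^k$ for all $k\ge K$. (iii) For each bounded subset $S\subset\mathcal H$ there are $\delta,\Delta>0$ such that $\delta\le\varphi_i(x)\le\Delta$ for all $x\in S$ and all $i\in I$. (iv) There is $\varepsilon>0$ such that $\lambda_{i,k}\in[\varepsilon,1]$ and $\alpha_k\in[\varepsilon,2-\varepsilon]$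 for all $k$ and all $i\in I_k$. (v) $\{I_k\}_{k=0}^\infty$ is $s$-intermittent for some integer $s\ge1$, that is, $I=I_k\cup\dots\cup I_{k+s}$ for all $k$. (vi) Each $T_i$, $i\in I$, is boundedly linearly regular. If the sequence $\{x_k\}_{k=0}^\infty$ is bounded, then $x_k\in C\cap Q$ for some $k$.
   Context: $\operatorname{Fix}T:=\{x\in\mathcal H: T(x)=x\}$. An operator $T\colon\mathcal H\to\mathcal H$ with $\operatorname{Fix}T\ne\emptyset$ is a cutter if $\langle z-T(x),x-T(x)\rangle\le0$ for all $x\in\mathcal H$ and all $z\in\operatorname{Fix}T$ (then $\operatorname{Fix}T$ is closed and convex). $P_Q$ is the metric projection onto $Q$, and $d(x,A):=\inf_{z\in A}\|x-z\|$. An operator $T$ with a fixed point is boundedly linearly regular if for every nonempty bounded $S\subset\mathcal H$ there is $\delta_S>0$ such that $\delta_S\,d(x,\operatorname{Fix}T)\le\|T(x)-x\|$ for all $x\in S$. *)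

(* Defs.v *)
From mathcomp Require Export all_boot all_order all_algebra.
From mathcomp Require Export all_classical all_reals all_analysis.

Set Implicit Arguments.
Unset Strict Implicit.
Unset Printing Implicit Defensive.

Import Order.TTheory GRing.Theory Num.Theory.
Import numFieldNormedType.Exports.

Local Open Scope classical_set_scope.
Local Open Scope ring_scope.

Definition fix_set (T : Type) (f : T -> T) : set T := [set x | f x = x].

Definition dist_set (R : realType) (V : normedModType R) (x : V) (A : set V)
    : R := inf [set `|x - z| | z in A].

(* The nearest point of Q to x. The default value x is returned only when no
   nearest point exists, which cannot happen for a nonempty closed convex subset
   of a Hilbert space. *)
Definition metric_proj (R : realType) (V : normedModType R) (Q : set V)
    (x : V) : V := xget x [set y | Q y /\ `|x - y| = dist_set x Q].

Definition cutter (R : realType) (V : normedModType R)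
    (dot : {dot V for @idfun R}) (T : V -> V) : Prop :=
  fix_set T !=set0 /\
  forall x z, fix_set T z -> dot (z - T x) (x - T x) <= 0.

Definition boundedly_linearly_regular (R : realType) (V : normedModType R)
    (T : V -> V) : Prop :=
  fix_set T !=set0 /\
  forall S : set V, S !=set0 -> bounded_set S ->
    exists2 delta : R, 0 < delta &
      forall x, S x -> delta * dist_set x (fix_set T) <= `|T x - x|.

Definition beta_coef (R : realType) (V : normedModType R) (r : R)
    (phi : V -> R) (T : V -> V) (x : V) : R :=
  if T x != x then (r / phi x + `|T x - x|) / `|T x - x| else 0.

Definition intermittent (I : finType) (s : nat) (J : nat -> {set I}) : Prop :=
  forall k, (\bigcup_(k <= j < (k + s).+1) J j)%SET = [set: I]%SET.

(* Main.v *)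
Require Import Defs.
From mathcomp Require Import lra ring zify.

Import Order.TTheory GRing.Theory Num.Theory.
Import numFieldNormedType.Exports.

Local Open Scope classical_set_scope.
Local Open Scope ring_scope.

Set Implicit Arguments.
Unset Strict Implicit.

(** Suppose that no iterate is a common fixed point. All iterates lie in [Q], so
    it suffices to contradict the slow decay of [r]. The
    argument shows that the method converges linearly, whereas every
    operator that moves an iterate does so by a length at least of the order of
    [r k].

    Each summand of the step overshoots [T i (x k)] by [r k / phi i (x k)]. A point
    [w] of [Q] is therefore not passed by the step if it lies deep enough in the
    half-spaces that the cutters provide; this depth is called [margin]. For such
    [w] the distance to the iterates decreases, and the square of the distance
    drops by a fixed multiple of the energy of the step, the sum of the squared
    lengths of the individual moves ([step_fejer]). Since [r] is nonincreasing, a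
    margin of [r l / delta] is sufficient for all steps from [l] on.

    A center [z] of a ball in the interior of the common fixed points has a fixed
    positive margin. If [x l] is within [eta] of each set of fixed points, a convex
    combination of [x l] and [z] has margin [r l / delta] and is at distance
    [O(eta + r l)] from [x l] ([margin_combination]). Take [l] to be an index at
    which some applied operator moves [x l]; each window of [s + 1] indices
    contains one ([active_index]). Let [E] be the energy of the window that starts
    at [l]. Bounded regularity and intermittency give [eta = O(sqrt E)], and the
    overshoot at [l] gives [r l = O(sqrt E)]. The total energy spent from [l] on is
    thus [O(E)] ([energy_window]). Hence the energy tails decay geometrically, and
    [r l ^ 2 = O(E)] makes [r] smaller than a geometric sequence infinitely often
    ([slow_sequence_contradiction]). *)

(** * Inner products and projections *)

Section InnerProduct.
Variables (R : realType) (H : completeNormedModType R).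
Variables (dot : {dot H for @idfun R}) (norm_dot : forall x, `|x| ^+ 2 = dot x x).

Lemma dotC u v : dot u v = dot v u.
Proof. by rewrite hermC expr0 mul1r. Qed.

Lemma dotDl u v w : dot (u + v) w = dot u w + dot v w.
Proof. exact: linearDl. Qed.

Lemma dotDr u v w : dot w (u + v) = dot w u + dot w v.
Proof. exact: linearDr. Qed.

Lemma dotNr u v : dot u (- v) = - dot u v.
Proof. exact: linearNr. Qed.

Lemma dotNl u v : dot (- u) v = - dot u v.
Proof. exact: linearNl. Qed.

Lemma dotZl a u v : dot (a *: u) v = a * dot u v.
Proof. exact: linearZl_LR. Qed.

Lemma dotZr a u v : dot u (a *: v) = a * dot u v.
Proof. exact: linearZr_LR. Qed.

Lemma dot_sumr (I : finType) (P : pred I) (F : I -> H) u :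
  dot u (\sum_(i | P i) F i) = \sum_(i | P i) dot u (F i).
Proof. exact: linear_sumr. Qed.

Lemma sqr_normD (u v : H) : `|u + v| ^+ 2 = `|u| ^+ 2 + 2 * dot u v + `|v| ^+ 2.
Proof. by rewrite !norm_dot dotDl !dotDr (dotC v u); ring. Qed.

Lemma sqr_normB (u v : H) : `|u - v| ^+ 2 = `|u| ^+ 2 - 2 * dot u v + `|v| ^+ 2.
Proof. by rewrite sqr_normD normrN dotNr mulrN. Qed.

Lemma parallelogram (u v : H) :
  `|u + v| ^+ 2 + `|u - v| ^+ 2 = 2 * `|u| ^+ 2 + 2 * `|v| ^+ 2.
Proof. rewrite sqr_normD sqr_normB; ring. Qed.

(** The lower half of Cauchy-Schwarz. It comes from expanding the square of
    [`|v| *: u + `|u| *: v], which is nonnegative and divisible by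
    [`|u| * `|v|]. *)
Lemma dot_ge_normM (u v : H) : - (`|u| * `|v|) <= dot u v.
Proof.
have [->|u0] := eqVneq u 0; first by rewrite normr0 mul0r oppr0 linear0l.
have [->|v0] := eqVneq v 0; first by rewrite normr0 mulr0 oppr0 linear0r.
have := exprn_ge0 2 (normr_ge0 (`|v| *: u + `|u| *: v)).
rewrite sqr_normD dotZl dotZr !normrZ !normr_id.
have u1 : 0 < `|u| by rewrite normr_gt0.
have v1 : 0 < `|v| by rewrite normr_gt0.
have -> : (`|v| * `|u|) ^+ 2 + 2 * (`|v| * (`|u| * dot u v)) + (`|u| * `|v|) ^+ 2
  = (2 * (`|v| * `|u|)) * (`|u| * `|v| + dot u v) by ring.
by rewrite pmulr_rge0 ?mulr_gt0 // -lerBlDl sub0r.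
Qed.

End InnerProduct.

Section Projection.
Variables (R : realType) (H : completeNormedModType R).
Variables (dot : {dot H for @idfun R}) (norm_dot : forall x, `|x| ^+ 2 = dot x x).
Variables (Q : set H) (Q_closed : closed Q) (Q_convex : convex_set Q).

Lemma convex_combination (x y : H) (t : R) : Q x -> Q y -> 0 <= t <= 1 ->
  Q (t *: x + (1 - t) *: y).
Proof.
move=> Qx Qy t01.
have := @Q_convex x y (Itv01 (andP t01).1 (andP t01).2).
by rewrite !inE; apply.
Qed.

Lemma dist_set_le (v w : H) : Q w -> dist_set v Q <= `|v - w|.
Proof.
move=> Qw; apply: ge_inf; last by exists w.
by exists 0 => _ [y _ <-].
Qed.

Lemma dist_set_approx (v : H) (A : set H) (e : R) : A !=set0 -> 0 < e ->
  exists2 w, A w & `|v - w| < dist_set v A + e.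
Proof.
move=> [w Aw] e0.
have [|_ [y Ay <-] lt_e] := @inf_adherent _ [set `|v - z| | z in A] e e0; last by exists y.
split; first by exists `|v - w|, w.
by exists 0 => _ [y _ <-].
Qed.

(** A minimizing sequence for the distance is Cauchy by the parallelogram law;
    completeness and closedness of [Q] provide its limit in [Q]. *)
Lemma nearest_point_exists (v : H) : Q !=set0 ->
  exists2 p, Q p & `|v - p| = dist_set v Q.
Proof.
move=> Q0; set d := dist_set v Q.
have d_ge0 : 0 <= d.
  apply: lb_le_inf; first by case: Q0 => w Qw; exists `|v - w|, w.
  by move=> _ [y _ <-].
(* The midpoint of y and w lies in Q, hence at distance at least d from v, and
   the parallelogram law then forces two almost nearest points together. *)
have near_min e y w : 0 < e -> Q y -> Q w -> `|v - y| < d + e -> `|v - w| < d + e ->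
    `|y - w| ^+ 2 <= 4 * e * (2 * d + e).
  move=> e0 Qy Qw ye we.
  have := parallelogram norm_dot (v - y) (v - w).
  have -> : v - y - (v - w) = w - y by rewrite opprB addrC addrA subrK.
  have -> : v - y + (v - w) = 2 *: (v - (2^-1 *: y + (1 - 2^-1) *: w)).
    rewrite (_ : 1 - 2^-1 = 2^-1) -?scalerDr; last by field.
    by rewrite scalerBr scalerA mulfV ?pnatr_eq0// scale1r scaler_nat mulr2n opprD addrACA.
  have : d <= `|v - (2^-1 *: y + (1 - 2^-1) *: w)|.
    by apply/dist_set_le/convex_combination => //; lra.
  rewrite normrZ (distrC w y) normr_nat.
  have := normr_ge0 (v - y); have := normr_ge0 (v - w).
  move: ye we.
  move: `|v - y| `|v - w| `|v - _| `|y - w| => a b c f; nra.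
have seq_ex n : exists y, Q y /\ `|v - y| < d + n.+1%:R^-1.
  have [||y Qy ltn] := @dist_set_approx v Q n.+1%:R^-1 => //.
  by exists y.
have [y yP] := choice seq_ex.
have y_cvg : cvgn y.
  apply: cauchy_cvg; apply: cauchy_exP => e e0.
  (* near_min bounds the square by 4 e' (2 d + e') < e' c as soon as e' <= 1. *)
  pose c := 4 * (2 * d + 1) + 1.
  have c_gt0 : 0 < c by rewrite /c; lra.
  pose e' := Num.min 1 (e ^+ 2 / c).
  have e'0 : 0 < e' by rewrite lt_min ltr01 divr_gt0 ?exprn_gt0.
  have e'1 : e' <= 1 by rewrite ge_min lexx.
  have e'c : e' * c <= e ^+ 2 by rewrite -ler_pdivlMr // ge_min lexx orbT.
  have [N _ HN] := near_infty_natSinv_lt (PosNum e'0).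
  exists (y N); exists N => // n /= Nn.
  have [QN yN] := yP N; have [Qn yn] := yP n.
  have := HN N (leqnn N); have := HN n Nn => /= ltn ltN.
  rewrite -ball_normE /= -(@ltr_pXn2r _ 2%N) ?nnegrE ?(ltW e0) //.
  have /= := @near_min e' _ _ e'0 QN Qn (lt_trans yN _) (lt_trans yn _).
  rewrite !ltrD2l => /(_ ltN ltn); move=> /le_lt_trans; apply.
  by move: e'c; rewrite /c; nra.
have Ql : Q (limn y).
  have yQ : \forall n \near \oo, Q (y n) by exists 0%N => // k _; case: (yP k).
  exact: (@closed_cvg _ _ _ _ y Q Q_closed yQ _ y_cvg).
exists (limn y) => //.
apply/le_anti/andP; split; last exact: dist_set_le.
apply/ler_addgt0Pr => e e0.
have e20 : 0 < e / 2 by rewrite divr_gt0.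
have [N _ HN] := near_infty_natSinv_lt (PosNum e20).
have /cvgrPdist_lt /(_ _ e20) [N' _ HN'] := y_cvg.
have := HN (maxn N N') (leq_maxl _ _); have := HN' (maxn N N') (leq_maxr _ _).
have [_] := yP (maxn N N') => /= H1 H2 H3.
have -> : v - limn y = (v - y (maxn N N')) - (limn y - y (maxn N N')).
  by rewrite opprB addrA addrNK.
apply: (le_trans (ler_normB _ _)); rewrite (splitr e) addrA.
by apply/ltW/ltrD => //; apply: (lt_trans H1); rewrite ltrD2l.
Qed.

Lemma metric_projP v : Q !=set0 ->
  Q (metric_proj Q v) /\ `|v - metric_proj Q v| = dist_set v Q.
Proof.
move=> /(nearest_point_exists v) [p Qp dp].
by rewrite /metric_proj; case: xgetP => [y _ []//|/(_ p)[]].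
Qed.

(** With [p] the projection of [v], the angle at [p] between [v - p] and
    [w - p] is obtuse: otherwise a short move from [p] towards [w] would stay
    in [Q] and come closer to [v]. Hence [`|v - w|] dominates [`|p - w|]. This is
    the part of nonexpansiveness that concerns points already in [Q]. *)
Lemma metric_proj_le (v w : H) : Q w -> `|metric_proj Q v - w| <= `|v - w|.
Proof.
move=> Qw; have [|] := @metric_projP v; first by exists w.
move: (metric_proj Q v) => p Qp dp.
have obtuse : dot (v - p) (w - p) <= 0.
  rewrite leNgt; apply/negP => pos.
  (* For this t the gain 2 t dot (v - p) (w - p) exceeds the loss
     t ^ 2 |w - p| ^ 2 in the square of the distance to v. *)
  pose t := Num.min 1 (dot (v - p) (w - p) / (`|w - p| ^+ 2 + 1)).
  have n0 := exprn_ge0 2 (normr_ge0 (w - p)).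
  have t0 : 0 < t by rewrite lt_min ltr01 divr_gt0 // ltr_wpDl.
  have t1 : t <= 1 by rewrite ge_min lexx.
  have tn : t * (`|w - p| ^+ 2 + 1) <= dot (v - p) (w - p).
    by rewrite -ler_pdivlMr ?ltr_wpDl // ge_min lexx orbT.
  have Qt : Q (t *: w + (1 - t) *: p) by apply: convex_combination => //; lra.
  have := dist_set_le v Qt; rewrite -dp.
  have -> : v - (t *: w + (1 - t) *: p) = (v - p) - t *: (w - p).
    by rewrite scalerBl scale1r scalerBr addrCA opprD addrA.
  rewrite -(@ler_pXn2r _ 2%N) ?nnegrE // (sqr_normB norm_dot (v - p)) normrZ dotZr exprMn.
  rewrite (ger0_norm (ltW t0)); nra.
rewrite -(@ler_pXn2r _ 2%N) ?nnegrE //.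
have -> : v - w = (v - p) - (w - p) by rewrite opprB addrA addrNK.
rewrite (sqr_normB norm_dot (v - p)) (distrC w p).
have := exprn_ge0 2 (normr_ge0 (v - p)); lra.
Qed.
End Projection.

(** * Margins and Fejer monotonicity *)

Section Margin.
Variables (R : realType) (H : completeNormedModType R).
Variables (dot : {dot H for @idfun R}) (norm_dot : forall x, `|x| ^+ 2 = dot x x).

(** A cutter [T] has, for every [y], the half-space through [T y] normal to
    [T y - y] as a supporting half-space of its fixed points. Saying that [w] has
    margin [rho] means that [w] is at depth at least [rho] in all these
    half-spaces. The condition is affine in [w], and this makes it more convenient
    than requiring the ball of radius [rho] around [w] to consist of fixed
    points. *)
Definition margin (T : H -> H) (rho : R) (w : H) : Prop :=
  forall y, rho * `|T y - y| + `|T y - y| ^+ 2 <= dot (w - y) (T y - y).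

Variable T : H -> H.
Hypothesis T_cutter : cutter dot T.

Lemma cutter_margin w : fix_set T w -> margin T 0 w.
Proof.
move=> Tw y; have := T_cutter.2 y _ Tw.
have -> : w - y = (w - T y) + (T y - y) by rewrite addrA subrK.
rewrite (dotDl dot (w - T y)) -norm_dot -(opprB (T y) y) dotNr; lra.
Qed.

(** The half-space inequality is applied to the point of the ball that is
    deepest in the direction [y - T y]. *)
Lemma margin_ball z rho : 0 <= rho ->
  (forall u : H, `|u| <= rho -> fix_set T (z + u)) -> margin T rho z.
Proof.
move=> rho0 ballT y.
have [->|ne] := eqVneq (T y - y) 0.
  by rewrite normr0 mulr0 expr0n addr0 linear0r.
have t0 : 0 < `|T y - y| by rewrite normr_gt0.
have := @cutter_margin (z + (rho / `|T y - y|) *: (y - T y)) (ballT _ _) y.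
rewrite -(opprB (T y) y) normrZ normrN ger0_norm ?divr_ge0// divfK ?gt_eqF// => /(_ (lexx _)).
rewrite addrAC (dotDl dot (z - y)) scalerN -scaleNr dotZl -norm_dot.
have -> : - (rho / `|T y - y|) * `|T y - y| ^+ 2 = - (rho * `|T y - y|).
  by field; rewrite gt_eqF.
lra.
Qed.

(** A point [x] at distance [eta] from the fixed points has margin at least
    [- eta]; since the margin is concave along segments, a move towards a
    point [z] of margin [rad] compensates this deficit. *)
Lemma margin_combination x z c (rad eta theta : R) :
  margin T rad z -> fix_set T c -> `|x - c| <= eta -> 0 <= theta <= 1 ->
  margin T (theta * rad - (1 - theta) * eta) ((1 - theta) *: x + theta *: z).
Proof.
move=> mz Tc xc /andP[th0 th1] y.
have -> : (1 - theta) *: x + theta *: z - y =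
   (1 - theta) *: (c - y) + (1 - theta) *: (x - c) + theta *: (z - y).
  rewrite -scalerDr [c - y + _]addrC addrA subrK !scalerBr addrACA -opprD.
  by rewrite -scalerDl subrK scale1r.
rewrite !dotDl !dotZl.
have := mz y; have := cutter_margin Tc y; rewrite mul0r add0r.
have := dot_ge_normM norm_dot (x - c) (T y - y).
have := normr_ge0 (T y - y).
have := normr_ge0 (x - c).
move: xc; move: (dot (x - c) _) (dot (z - y) _) (dot (c - y) _).
move: `|x - c| `|T y - y| => a t X Z C ae a0 t0 HX HC HZ.
have HX' : - (eta * t) <= X by nra.
nra.
Qed.

(** The step for [T] overshoots [T x] by the length [r / phi x]. A margin of that
    size at [w] is what is needed for the overshot point to be still on the near
    side of [w], as for a cutter. *)
Lemma beta_dir_dot (r : R) (phi : H -> R) rho w x : 0 < r -> 0 < phi x ->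
  margin T rho w -> r / phi x <= rho ->
  `|beta_coef r phi T x *: (T x - x)| ^+ 2 <=
    dot (w - x) (beta_coef r phi T x *: (T x - x)).
Proof.
move=> r0 phi0 mw le_rho; rewrite /beta_coef; case: ifP => ne; last first.
  by rewrite scale0r normr0 linear0r expr0n.
have t0 : 0 < `|T x - x| by rewrite normr_gt0 subr_eq0.
have := mw x; rewrite dotZr normrZ.
have f0 : 0 < r / phi x by rewrite divr_gt0.
move: (r / phi x) f0 le_rho (dot _ _) => f f0 le_rho D HD.
rewrite ger0_norm ?divr_ge0 ?addr_ge0 ?(ltW f0) // divfK ?gt_eqF//.
rewrite mulrAC ler_pdivlMr //.
rewrite expr2 -mulrA ler_pM2l ?addr_gt0//; nra.
Qed.

Lemma norm_beta_dir (r : R) (phi : H -> R) x : 0 < r -> 0 < phi x ->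
  T x <> x -> `|beta_coef r phi T x *: (T x - x)| = r / phi x + `|T x - x|.
Proof.
move=> r0 phi0 /eqP ne; rewrite /beta_coef ne normrZ.
have t0 : 0 < `|T x - x| by rewrite normr_gt0 subr_eq0.
rewrite ger0_norm ?divfK ?gt_eqF//.
by rewrite divr_ge0 ?addr_ge0 ?divr_ge0 ?ltW.
Qed.

End Margin.

Section Averaged.
Variables (R : realType) (H : completeNormedModType R).
Variables (dot : {dot H for @idfun R}) (norm_dot : forall x, `|x| ^+ 2 = dot x x).
Variables (I : finType) (J : {set I}) (lam : I -> R) (u : I -> H).
Hypotheses (lam_ge0 : forall i, i \in J -> 0 <= lam i)
           (lam_sum : \sum_(i in J) lam i = 1).

Lemma norm_average_le (sigma : R) : (forall i, i \in J -> `|u i| <= sigma) ->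
  `|\sum_(i in J) lam i *: u i| <= sigma.
Proof.
move=> us; apply: (le_trans (ler_norm_sum _ _ _)).
rewrite -[leRHS]mul1r -lam_sum mulr_suml; apply: ler_sum => i iJ.
by rewrite normrZ ger0_norm ?lam_ge0 // ler_wpM2l ?lam_ge0 ?us.
Qed.

(** Jensen's inequality, in the form of a nonnegative variance. *)
Lemma sqr_norm_average : `|\sum_(i in J) lam i *: u i| ^+ 2 <=
  \sum_(i in J) lam i * `|u i| ^+ 2.
Proof.
set a := \sum_(i in J) lam i *: u i.
have : 0 <= \sum_(i in J) lam i * `|u i - a| ^+ 2.
  by apply: sumr_ge0 => i iJ; rewrite mulr_ge0 ?lam_ge0 ?exprn_ge0.
have -> : \sum_(i in J) lam i * `|u i - a| ^+ 2 =
   \sum_(i in J) lam i * `|u i| ^+ 2 - 2 * dot a a + `|a| ^+ 2.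
  rewrite {2}/a dot_sumr mulr_sumr -sumrB.
  rewrite [X in _ = _ + X](_ : _ = \sum_(i in J) lam i * `|a| ^+ 2); last first.
    by rewrite -mulr_suml lam_sum mul1r.
  rewrite -big_split /=; apply: eq_bigr => i _.
  by rewrite (sqr_normB norm_dot) // dotZr (dotC dot a); ring.
rewrite -norm_dot; lra.
Qed.

(** If every direction [u i] satisfies the cutter inequality with respect to [w],
    then so does their average, and a relaxation by [alpha] in [0, 2] decreases
    the distance to [w]. *)
Lemma relaxed_average_fejer (alpha : R) w x : 0 <= alpha ->
  (forall i, i \in J -> `|u i| ^+ 2 <= dot (w - x) (u i)) ->
  `|x + alpha *: (\sum_(i in J) lam i *: u i) - w| ^+ 2 <=
  `|x - w| ^+ 2 - alpha * (2 - alpha) * \sum_(i in J) lam i * `|u i| ^+ 2.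
Proof.
move=> a0 Hu; rewrite addrAC (sqr_normD norm_dot) dotZr normrZ exprMn ger0_norm //.
have Hs : \sum_(i in J) lam i * `|u i| ^+ 2 <= dot (w - x) (\sum_(i in J) lam i *: u i).
  rewrite dot_sumr; apply: ler_sum => i iJ.
  by rewrite dotZr ler_wpM2l ?lam_ge0 ?Hu.
have := sqr_norm_average.
have -> : dot (x - w) (\sum_(i in J) lam i *: u i) = - dot (w - x) (\sum_(i in J) lam i *: u i).
  by rewrite -(opprB w x) dotNl.
move: Hs; move: (\sum_(i in J) lam i * _) (dot _ _) (`|\sum_(i in J) _| ^+ 2) => S D A.
nra.
Qed.
End Averaged.

(** * Geometric decay of tails *)

Section Rate.
Variables (R : realType).

Lemma bernoulli_ineq (h : R) n : 0 <= h <= 1 -> 1 - n%:R * h <= (1 - h) ^+ n.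
Proof.
move=> /andP[h0 h1]; elim: n => [|n IH]; first by rewrite mul0r subr0 expr0.
rewrite exprS -natr1.
have := @ler_wpM2l _ (1 - h) _ _ _ IH; rewrite subr_ge0 => /(_ h1).
have : 0 <= n%:R :> R by rewrite ler0n.
move: (_ ^+ n) (n%:R) => a b; nra.
Qed.

Variables (g r : nat -> R) (s : nat).
Hypothesis g_ge0 : forall k, 0 <= g k.

(** Write [E] for the block sum and [X] for the sum after the block. Both
    [X <= b - E] and [X <= (M - 1) * E] hold; eliminating [E] gives the claim. *)
Lemma tail_contraction (M b : R) l : 1 < M ->
  (forall n, \sum_(l <= j < n) g j <= M * \sum_(l <= j < l + s.+1) g j) ->
  (forall n, \sum_(l <= j < n) g j <= b) ->
  forall n, \sum_(l + s.+1 <= j < n) g j <= (1 - M^-1) * b.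
Proof.
move=> M1 HM Hb n.
have M0 : 0 < M by lra.
have E0 : 0 <= \sum_(l <= j < l + s.+1) g j by apply: sumr_ge0.
have [le_n|gt_n] := leqP n (l + s.+1).
  rewrite big_geq // mulr_ge0 //; first by rewrite subr_ge0 invf_le1 // ltW.
  exact: le_trans (Hb (l + s.+1)%N).
have := HM n; have := Hb n.
rewrite (@big_cat_nat _ _ _ (l + s.+1)) /=; [|lia|lia].
move: (\sum_(l <= j < _) _) (\sum_(_ <= j < n) _) E0 => E X E0 h1 h2.
have -> : (1 - M^-1) * b = ((M - 1) * b) / M by field; rewrite gt_eqF.
rewrite ler_pdivlMr //; nra.
Qed.

Lemma tail_mono (b : R) k l : (k <= l)%N ->
  (forall n, \sum_(k <= j < n) g j <= b) ->
  (forall n, \sum_(l <= j < n) g j <= b).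
Proof.
move=> kl Hb n; have [ln|nl] := leqP l n.
  apply: le_trans (Hb n); rewrite (@big_cat_nat _ _ _ l k) //= lerDr.
  exact: sumr_ge0.
rewrite big_geq ?(ltnW nl)//.
by apply: le_trans (Hb k); rewrite big_geq.
Qed.

(** The tails of [g] are contracted by the factor [1 - M^-1] over every
    [2 * s + 1] indices, so some [(a * r l) ^+ 2] is below a geometric sequence in
    each such block. This contradicts that [r] decays more slowly than any
    geometric sequence. *)
Lemma slow_sequence_contradiction (M a : R) K : 1 < M -> 0 < a ->
  (forall k, 0 < r k) ->
  (forall q c : R, 0 < q < 1 -> 0 < c ->
     exists K : nat, forall k, (K <= k)%N -> c * q ^+ k < r k) ->
  (forall k, (K <= k)%N -> exists l, [/\ (k <= l <= k + s)%N,
     (a * r l) ^+ 2 <= g l &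
     forall n, \sum_(l <= j < n) g j <= M * \sum_(l <= j < l + s.+1) g j]) ->
  False.
Proof.
move=> M1 a0 r0 slow act.
have [l0 [/andP[Kl0 _] _ Hl0]] := act K (leqnn K).
pose b := M * \sum_(l0 <= j < l0 + s.+1) g j.
have b0 : 0 <= b by rewrite mulr_ge0 ?sumr_ge0 //; lra.
pose q := 1 - M^-1; pose N := s.*2.+1.
have M'0 : 0 < M^-1 by rewrite invr_gt0; lra.
have M'1 : M^-1 < 1 by rewrite invf_lt1; lra.
have q0 : 0 < q by rewrite /q; lra.
have tails p : forall n, \sum_(l0 + p * N <= j < n) g j <= b * q ^+ p.
  elim: p => [|p IH]; first by rewrite mul0n addn0 expr0 mulr1.
  have [|l [/andP[l1 l2] _ Hl]] := act (l0 + p * N)%N; first by lia.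
  apply: (@tail_mono _ (l + s.+1)); first by rewrite /N; lia.
  rewrite exprS mulrCA; exact: tail_contraction M1 Hl (tail_mono l1 IH).
(* p is a ratio with p ^ (2 N) >= q, obtained without taking roots from
   Bernoulli's inequality. *)
pose h := M^-1 / (2 * N)%:R.
have NN : 1 <= (2 * N)%:R :> R by rewrite ler1n.
have h0 : 0 < h by rewrite divr_gt0 //; lra.
have hN : (2 * N)%:R * h = M^-1 by rewrite /h mulrC divfK // gt_eqF //; lra.
have h1 : h < 1 by nra.
pose p := 1 - h.
have p0 : 0 < p by rewrite /p; lra.
have p1 : p < 1 by rewrite /p; lra.
have pq : q <= (p ^+ N) ^+ 2.
  rewrite -exprM mulnC /q -hN; apply: bernoulli_ineq; lra.
(* p ^ (l0 + s) accounts for the position of l in its block, and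
   (1 + b) ^ 2 > b makes the final comparison strict. *)
pose c := (1 + b) / (a * p ^+ (l0 + s)).
have c0 : 0 < c by rewrite divr_gt0 ?mulr_gt0 ?exprn_gt0 //; lra.
have [|K' HK'] := slow p c _ c0; first by rewrite p0.
have [|l [/andP[l1 l2] gl _]] := act (l0 + K' * N)%N.
  exact: leq_trans Kl0 (leq_addr _ _).
have rl : c * p ^+ l < r l.
  apply/HK'/(leq_trans _ l1)/(leq_trans _ (leq_addl _ _)).
  by rewrite leq_pmulr.
have gl2 : g l <= b * q ^+ K'.
  by have := tail_mono l1 (tails K') l.+1; rewrite big_nat1.
have lowp : (1 + b) * p ^+ (K' * N) < a * r l.
  apply: le_lt_trans (_ : a * (c * p ^+ l) < _); last by rewrite ltr_pM2l.
  have : p ^+ (l0 + s) * p ^+ (K' * N) <= p ^+ l.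
    by rewrite -exprD; apply: ler_wiXn2l; rewrite ?(ltW p0) ?(ltW p1) // addnAC.
  have -> : a * (c * p ^+ l) = (1 + b) * (p ^+ l / p ^+ (l0 + s)).
    by rewrite /c; field; rewrite ?expf_neq0 ?gt_eqF.
  rewrite ler_pM2l; last lra.
  by rewrite ler_pdivlMr ?exprn_gt0 // mulrC.
have : q ^+ K' <= (p ^+ (K' * N)) ^+ 2.
  rewrite mulnC exprM exprAC.
  by apply: lerXn2r; rewrite ?nnegrE ?exprn_ge0 ?(ltW q0) ?(ltW p0).
have : 0 < p ^+ (K' * N) by rewrite exprn_gt0.
have : 0 < q ^+ K' by rewrite exprn_gt0.
have := r0 l.
move: (p ^+ (K' * N)) (q ^+ K') (r l) lowp gl gl2 => P X y lowp gl2' gl2'' y0 P0 X0 XP.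
have : ((1 + b) * P) ^+ 2 < (a * y) ^+ 2 by rewrite ltr_pXn2r ?nnegrE ?mulr_ge0 ?ltW //; lra.
have : b * X < (1 + b) ^+ 2 * X by rewrite ltr_pM2r //; nra.
have : (1 + b) ^+ 2 * X <= (1 + b) ^+ 2 * P ^+ 2 by rewrite ler_wpM2l ?exprn_ge0 //; lra.
rewrite -exprMn; lra.
Qed.
End Rate.

(** * The iteration *)

Section Iteration.
Variables (R : realType) (H : completeNormedModType R).
Variables (dot : {dot H for @idfun R}) (norm_dot : forall x, `|x| ^+ 2 = dot x x).
Variables (m : nat) (T : 'I_m -> H -> H) (T_cutter : forall i, cutter dot (T i)).
Variables (Q : set H) (Q_closed : closed Q) (Q_convex : convex_set Q).
Variables (r : nat -> R) (phi : 'I_m -> H -> R) (alpha : nat -> R).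
Variables (Ik : nat -> {set 'I_m}) (lambda : 'I_m -> nat -> R) (x : nat -> H).
Hypotheses (r_gt0 : forall k, 0 < r k) (r_decr : forall k, r k.+1 <= r k).
Hypothesis phi_gt0 : forall i y, 0 < phi i y.
Hypothesis lambda_sum : forall k, \sum_(i in Ik k) lambda i k = 1.

Definition overstep k i : H :=
  beta_coef (r k) (phi i) (T i) (x k) *: (T i (x k) - x k).

Definition step_energy k : R := \sum_(i in Ik k) `|overstep k i| ^+ 2.

Hypothesis x0_in : Q (x 0%N).
Hypothesis x_rec : forall k, x k.+1 =
  metric_proj Q (x k + alpha k *: \sum_(i in Ik k) lambda i k *: overstep k i).

Variable eps : R.
Hypotheses (eps_gt0 : 0 < eps)
  (lambda_ge : forall k i, i \in Ik k -> eps <= lambda i k)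
  (alpha_ge : forall k, eps <= alpha k <= 2 - eps).

Lemma iterate_in k : Q (x k).
Proof.
case: k => [//|k]; rewrite x_rec.
by apply: (metric_projP norm_dot Q_closed Q_convex _ _).1; exists (x 0%N).
Qed.

Lemma step_energy_ge0 k : 0 <= step_energy k.
Proof. by apply: sumr_ge0 => i _; rewrite exprn_ge0. Qed.

Lemma overstep_le_energy k i : i \in Ik k -> `|overstep k i| ^+ 2 <= step_energy k.
Proof.
move=> ik; rewrite /step_energy (bigD1 i) //= lerDl.
by apply: sumr_ge0 => j _; rewrite exprn_ge0.
Qed.

Lemma residual_le_overstep k i : `|T i (x k) - x k| <= `|overstep k i|.
Proof.
have [->|ne] := pselect (T i (x k) = x k); first by rewrite subrr normr0.
by rewrite /overstep norm_beta_dir // lerDr divr_ge0 ?ltW.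
Qed.

Lemma lambda_ge0 k i : i \in Ik k -> 0 <= lambda i k.
Proof. by move=> /lambda_ge; apply: le_trans; exact: ltW. Qed.

Lemma step_length_le k sigma : (forall i, i \in Ik k -> `|overstep k i| <= sigma) ->
  `|x k.+1 - x k| <= 2 * sigma.
Proof.
move=> Hs; rewrite x_rec.
apply: (le_trans (metric_proj_le norm_dot Q_closed Q_convex _ (iterate_in k))).
have /andP[a1 a2] := alpha_ge k.
have a0 : 0 <= alpha k by exact: le_trans (ltW eps_gt0) a1.
rewrite addrC addKr normrZ ger0_norm //.
have := norm_average_le (@lambda_ge0 k) (lambda_sum k) Hs.
have := normr_ge0 (\sum_(i in Ik k) lambda i k *: overstep k i).
move: `|\sum_(i in Ik k) _| => n n0 ns.
apply: ler_pM => //; apply: (le_trans a2).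
by rewrite gerBl ltW.
Qed.

(** The decrease is measured by the energy of the step. The factor [eps ^+ 3]
    combines a lower bound [eps] for the weights and [eps ^+ 2] for
    [alpha * (2 - alpha)]. *)
Lemma step_fejer k w rho : Q w -> (forall i, margin dot (T i) rho w) ->
  (forall i, r k / phi i (x k) <= rho) ->
  `|x k.+1 - w| ^+ 2 <= `|x k - w| ^+ 2 - eps ^+ 3 * step_energy k.
Proof.
move=> Qw mw rho_ge; have /andP[a1 a2] := alpha_ge k.
have a0 : 0 <= alpha k by exact: le_trans (ltW eps_gt0) a1.
have /le_trans : `|x k.+1 - w| ^+ 2 <= `|x k + alpha k *:
    \sum_(i in Ik k) lambda i k *: overstep k i - w| ^+ 2.
  rewrite ler_pXn2r ?nnegrE // x_rec.
  exact: (metric_proj_le norm_dot Q_closed Q_convex).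
apply.
have dir i : i \in Ik k -> `|overstep k i| ^+ 2 <= dot (w - x k) (overstep k i).
  by move=> _; exact: (beta_dir_dot (r_gt0 k) (phi_gt0 i (x k)) (mw i) (rho_ge i)).
apply: (le_trans (relaxed_average_fejer norm_dot (@lambda_ge0 k) (lambda_sum k) a0 dir)).
rewrite lerD2l lerN2.
have : eps * step_energy k <= \sum_(i in Ik k) lambda i k * `|overstep k i| ^+ 2.
  rewrite mulr_sumr; apply: ler_sum => i ik.
  by rewrite ler_wpM2r ?exprn_ge0 ?lambda_ge.
have := step_energy_ge0 k.
move: (step_energy k) (\sum_(i in Ik k) _) => g S g0 gS.
have aa : eps ^+ 2 <= alpha k * (2 - alpha k).
  by rewrite expr2 ler_pM ?(ltW eps_gt0) // lerBrDr addrC -lerBrDr.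
have -> : eps ^+ 3 * g = eps ^+ 2 * (eps * g) by ring.
by apply: ler_pM => //; rewrite ?exprn_ge0 ?mulr_ge0 // ltW.
Qed.

Variables (delta Delta : R).
Hypotheses (delta_gt0 : 0 < delta)
  (phi_bounds : forall k i, delta <= phi i (x k) <= Delta).

Lemma relaxation_le k l i : (l <= k)%N -> r k / phi i (x k) <= r l / delta.
Proof.
move=> lk; have /andP[d1 _] := phi_bounds k i.
apply: ler_pM; rewrite ?invr_ge0 ?(ltW (r_gt0 _)) ?(ltW (phi_gt0 _ _)) //.
- elim: k lk {d1} => [|k IH]; first by rewrite leqn0 => /eqP ->.
  by rewrite leq_eqVlt => /orP[/eqP -> //|/IH]; exact: le_trans.
- by rewrite lef_pV2 ?posrE.
Qed.

Lemma energy_sum_le l w n : Q w -> (forall i, margin dot (T i) (r l / delta) w) ->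
  eps ^+ 3 * \sum_(l <= j < n) step_energy j <= `|x l - w| ^+ 2.
Proof.
move=> Qw mw; have [ln|nl] := leqP l n; last first.
  by rewrite big_geq ?(ltnW nl) // mulr0 exprn_ge0.
suff : `|x n - w| ^+ 2 + eps ^+ 3 * \sum_(l <= j < n) step_energy j <= `|x l - w| ^+ 2.
  by apply: le_trans; rewrite lerDr exprn_ge0.
elim: n ln => [|n IH]; first by rewrite leqn0 => /eqP ->; rewrite big_geq // mulr0 addr0.
rewrite leq_eqVlt => /orP[/eqP <-|ln]; first by rewrite big_geq // mulr0 addr0.
have := IH ln; have := step_fejer Qw mw (fun i => @relaxation_le n l i ln).
by rewrite big_nat_recr //=; lra.
Qed.

Variables (s : nat) (L rad B : R) (z : H).
Hypothesis Ik_inter : intermittent s Ik.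
Hypotheses (L_ge0 : 0 <= L)
  (regular : forall k i, dist_set (x k) (fix_set (T i)) <= L * `|T i (x k) - x k|).
Hypotheses (rad_gt0 : 0 < rad) (Qz : Q z) (mz : forall i, margin dot (T i) rad z)
  (x_bounded : forall k, `|x k - z| <= B).

Lemma window_index k i : exists2 j, (k <= j <= k + s)%N & i \in Ik j.
Proof.
have : i \in (\bigcup_(k <= j < (k + s).+1) Ik j)%SET by rewrite Ik_inter inE.
rewrite big_nat_cond big_seq_cond; elim/big_ind: _ => [|A1 A2 H1 H2|j].
- by rewrite inE.
- by rewrite inE => /orP[/H1|/H2].
- by rewrite ltnS => /andP[_ /andP[? _]] ?; exists j.
Qed.

(** If all operators applied in a window fix the current iterate, then the
    iterate does not move during the window, and all operators fix it because
    each of them is applied at least once. *)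
Lemma active_index k : (exists i, T i (x k) <> x k) ->
  exists l i, [/\ (k <= l <= k + s)%N, i \in Ik l & T i (x l) <> x l].
Proof.
move=> [i0 ne0]; apply: contrapT => Hno.
have stay l : (k <= l <= k + s)%N -> forall i, i \in Ik l -> T i (x l) = x l.
  by move=> kl i il; apply: contrapT => ne; apply: Hno; exists l, i.
have const n : (n <= s)%N -> x (k + n)%N = x k.
  elim: n => [|n IH] ns; first by rewrite addn0.
  rewrite addnS -IH ?(ltnW ns) //; apply/eqP; rewrite -subr_eq0 -normr_le0.
  rewrite -[leRHS](mulr0 2); apply: step_length_le => i ik.
  rewrite /overstep (stay (k + n)%N) ?subrr ?scaler0 ?normr0 //.
  by rewrite leq_addr leq_add2l ltnW.
have [j /andP[kj js] ij] := window_index k i0.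
apply: ne0; have <- : x j = x k by rewrite -(subnKC kj) const // leq_subLR.
by apply: stay => //; rewrite kj js.
Qed.

(** The ratio between the distance to a suitable point of margin [r l / delta] and
    the square root of the energy spent in the window that starts at [l]. The
    summands bound the drift in the window, the regularity error, the slack in
    the choice of almost nearest fixed points, and the margin itself. *)
Definition linear_const : R := (2 * s%:R + L + 1 + Delta / delta) * B / rad.

(** At an active index the energy [E] of the following window controls the
    distance from [x l] to a point [w] of [Q] with margin [r l / delta]: by
    regularity, [x l] is at distance [O(sqrt E)] from each set of fixed points, and
    [r l = O(sqrt E)] because some operator acts at [l] with an overstep of
    length at least [r l / Delta]. By Fejer monotonicity with respect to [w], all
    the energy still to be spent is [O(E)]. *)
Lemma energy_window l i0 : r l / delta <= rad -> i0 \in Ik l -> T i0 (x l) <> x l ->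
  (r l / Delta) ^+ 2 <= step_energy l /\
  forall n, \sum_(l <= j < n) step_energy j <=
    (linear_const ^+ 2 / eps ^+ 3) * \sum_(l <= j < l + s.+1) step_energy j.
Proof.
move=> rl_rad i0l ne; set E := \sum_(l <= j < l + s.+1) step_energy j.
have /andP[phi1 phi2] := phi_bounds l i0.
have Delta_gt0 : 0 < Delta by exact: lt_le_trans (lt_le_trans delta_gt0 phi1) phi2.
have energy_le j : (l <= j <= l + s)%N -> step_energy j <= E.
  move=> /andP[lj js]; rewrite /E (@big_cat_nat _ _ _ j) /=; [|lia|lia].
  rewrite [X in _ + X]big_ltn ?ltnS ?leq_addr //; last by lia.
  rewrite addrCA lerDl addr_ge0 //; apply: sumr_ge0 => ? _; exact: step_energy_ge0.
pose sigma := Num.sqrt E.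
have over_le j i : (l <= j <= l + s)%N -> i \in Ik j -> `|overstep j i| <= sigma.
  move=> lj ij; rewrite -[leLHS]ger0_norm // -sqrtr_sqr ler_wsqrtr //.
  exact: le_trans (overstep_le_energy ij) (energy_le j lj).
have rl_over : r l / Delta <= `|overstep l i0|.
  rewrite /overstep norm_beta_dir // -[leLHS]addr0 lerD //.
  by rewrite ler_pM2l // lef_pV2 ?posrE.
have ll : (l <= l <= l + s)%N by rewrite leqnn leq_addr.
have rl0 : 0 < r l / Delta by rewrite divr_gt0.
split.
  apply: le_trans (overstep_le_energy i0l).
  by apply: lerXn2r; rewrite ?nnegrE ?(ltW rl0).
have rl_sigma : r l / Delta <= sigma by exact: le_trans rl_over (over_le l i0 ll i0l).
have sigma_gt0 : 0 < sigma by exact: lt_le_trans rl0 rl_sigma.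
have drift n : (n <= s)%N -> `|x (l + n)%N - x l| <= n%:R * (2 * sigma).
  elim: n => [|n IH] ns; first by rewrite addn0 subrr normr0 mul0r.
  rewrite addnS -natr1 mulrDl mul1r [leRHS]addrC.
  rewrite -(subrK (x (l + n)%N) (x _.+1)) -addrA; apply: (le_trans (ler_normD _ _)).
  apply: lerD; last exact: IH (ltnW ns).
  by apply: step_length_le => i; apply: over_le; rewrite leq_addr leq_add2l ltnW.
pose eta := (2 * s%:R + L + 1) * sigma.
have near_fix i : exists2 c, fix_set (T i) c & `|x l - c| <= eta.
  have [j lj ij] := window_index l i; have /andP[lj1 lj2] := lj.
  have fix0 : fix_set (T i) !=set0 by case: (T_cutter i).
  have [c Tc xc] := dist_set_approx (x j) fix0 sigma_gt0.
  exists c => //.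
  have res : `|T i (x j) - x j| <= sigma.
    exact: le_trans (residual_le_overstep j i) (over_le j i lj ij).
  have /drift : (j - l <= s)%N by rewrite leq_subLR.
  rewrite subnKC // distrC => drift_j.
  have sj : (j - l)%:R <= s%:R :> R by rewrite ler_nat leq_subLR.
  rewrite -(subrK (x j) (x l)) -addrA; apply: (le_trans (ler_normD _ _)).
  have reg := regular j i.
  have Lres : L * `|T i (x j) - x j| <= L * sigma by rewrite ler_wpM2l.
  have dj : (j - l)%:R * (2 * sigma) <= s%:R * (2 * sigma).
    by rewrite ler_wpM2r // mulr_ge0 // ltW.
  have -> : eta = s%:R * (2 * sigma) + (L * sigma + sigma) by rewrite /eta; ring.
  apply: lerD; first exact: le_trans drift_j dj.
  apply: (le_trans (ltW xc)); rewrite lerD2r.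
  exact: le_trans reg Lres.
have eta0 : 0 < eta.
  by rewrite mulr_gt0 // ltr_wpDl // addr_ge0 // mulr_ge0.
pose rho := r l / delta.
have rho0 : 0 < rho by rewrite divr_gt0.
have rho_sigma : rho <= Delta / delta * sigma.
  rewrite mulrAC ler_pM2r ?invr_gt0 //.
  by rewrite mulrC -ler_pdivrMr.
(* This theta solves theta * rad - (1 - theta) * eta = rho. *)
pose theta := (eta + rho) / (eta + rad).
have er0 : 0 < eta + rad by rewrite addr_gt0.
have theta0 : 0 <= theta by rewrite divr_ge0 ?(ltW er0) // addr_ge0 ?ltW.
have theta1 : theta <= 1 by rewrite ler_pdivrMr // mul1r lerD2l.
pose w := (1 - theta) *: x l + theta *: z.
have Qw : Q w.
  have := @convex_combination _ _ _ Q_convex z (x l) theta Qz (iterate_in l).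
  by rewrite theta0 theta1 addrC; apply.
have mw i : margin dot (T i) rho w.
  have [c Tc xc] := near_fix i.
  have -> : rho = theta * rad - (1 - theta) * eta.
    by rewrite /theta; field; rewrite gt_eqF.
  by apply: (margin_combination norm_dot (T_cutter i) (mz i) Tc xc); rewrite theta0.
have xw : `|x l - w| <= linear_const * sigma.
  have -> : x l - w = theta *: (x l - z).
    by rewrite /w scalerBl scale1r scalerBr -addrA opprD addNKr opprD opprK.
  rewrite normrZ ger0_norm //.
  have B0 : 0 <= B by exact: le_trans (normr_ge0 _) (x_bounded l).
  have th : theta <= (2 * s%:R + L + 1 + Delta / delta) * sigma / rad.
    rewrite /theta; apply: ler_pM; rewrite ?invr_ge0 ?(ltW er0) //.
    - by rewrite addr_ge0 ?ltW.
    - by rewrite mulrDl lerD2l.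
    - by rewrite lef_pV2 ?posrE // lerDr ltW.
  have -> : linear_const * sigma =
      (2 * s%:R + L + 1 + Delta / delta) * sigma / rad * B.
    by rewrite /linear_const; field; rewrite !gt_eqF.
  exact: ler_pM.
move=> n; rewrite mulrAC ler_pdivlMr ?exprn_gt0 // mulrC.
apply: (le_trans (energy_sum_le n Qw mw)).
have -> : E = sigma ^+ 2.
  by rewrite sqr_sqrtr // sumr_ge0 // => ? _; exact: step_energy_ge0.
rewrite -exprMn; apply: lerXn2r => //; rewrite nnegrE //.
exact: le_trans (normr_ge0 _) xw.
Qed.

Lemma exists_common_fixed_iterate : r @ \oo --> (0 : R) ->
  (forall q c : R, 0 < q < 1 -> 0 < c ->
     exists K : nat, forall k, (K <= k)%N -> c * q ^+ k < r k) ->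
  exists k, forall i, T i (x k) = x k.
Proof.
move=> r_cvg slow; apply: contrapT => Hno.
have never k : exists i, T i (x k) <> x k.
  apply: contrapT => H1; apply: Hno; exists k => i.
  by apply: contrapT => H2; apply: H1; exists i.
have [K HK] : exists K, forall k, (K <= k)%N -> r k / delta <= rad.
  have /cvgrPdist_lt /(_ (rad * delta)) := r_cvg.
  rewrite mulr_gt0 // => /(_ isT) [K _ HK]; exists K => k /HK /=.
  by rewrite sub0r normrN gtr0_norm // ler_pdivrMr // => /ltW.
have [i0 _] := never 0%N.
have Delta0 : 0 < Delta.
  have /andP[p1 p2] := phi_bounds 0%N i0.
  exact: lt_le_trans (lt_le_trans delta_gt0 p1) p2.
pose M := linear_const ^+ 2 / eps ^+ 3 + 2.
have M0 : 0 <= linear_const ^+ 2 / eps ^+ 3.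
  by rewrite divr_ge0 ?sqr_ge0 // exprn_ge0 // ltW.
apply: (@slow_sequence_contradiction R step_energy r s step_energy_ge0 M Delta^-1 K) => //.
- by rewrite /M ltr_wpDl // ltr1n.
- by rewrite invr_gt0.
move=> k Kk; have [l [i [/andP[kl ls] il ne]]] := active_index (never k).
exists l; have [e1 e2] := energy_window (HK l (leq_trans Kk kl)) il ne.
split; [by rewrite kl | by rewrite mulrC |].
move=> n; apply: (le_trans (e2 n)); rewrite /M mulrDl lerDl mulr_ge0 //.
by apply: sumr_ge0 => ? _; exact: step_energy_ge0.
Qed.
End Iteration.

Unset Implicit Arguments.

Theorem theorem3p1 (R : realType) (H : completeNormedModType R)
    (* a real Hilbert space: the complete norm of H is induced by dot *)
    (dot : {dot H for @idfun R}) (norm_dot : forall x, `|x| ^+ 2 = dot x x)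
    (m : nat) (m_ge1 : (1 <= m)%N)
    (T : 'I_m -> H -> H) (T_cutter : forall i, cutter dot (T i))
    (Q : set H) (Q_closed : closed Q) (Q_convex : convex_set Q)
    (r : nat -> R) (r_gt0 : forall k, 0 < r k)
    (phi : 'I_m -> H -> R) (phi_gt0 : forall i x, 0 < phi i x)
    (alpha : nat -> R) (alpha_range : forall k, 0 < alpha k < 2)
    (Ik : nat -> {set 'I_m}) (Ik_neq0 : forall k, Ik k != finset.set0)
    (lambda : 'I_m -> nat -> R)
    (lambda_range : forall k i, i \in Ik k -> 0 < lambda i k <= 1)
    (lambda_sum : forall k, \sum_(i in Ik k) lambda i k = 1)
    (x : nat -> H) (x0_in : Q (x 0%N))
    (x_rec : forall k, x k.+1 = metric_proj Q (x k + alpha k *: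
       \sum_(i in Ik k)
         (lambda i k * beta_coef (r k) (phi i) (T i) (x k)) *: (T i (x k) - x k))) :
  let C := \bigcap_i fix_set (T i) in
  C° `&` Q !=set0 ->
  r @ \oo --> (0 : R) ->
  (forall k, r k.+1 <= r k) ->
  (forall q c : R, 0 < q < 1 -> 0 < c ->
     exists K : nat, forall k, (K <= k)%N -> c * q ^+ k < r k) ->
  (forall S : set H, bounded_set S ->
     exists delta Delta : R, [/\ 0 < delta, 0 < Delta &
       forall y i, S y -> delta <= phi i y <= Delta]) ->
  (exists2 eps : R, 0 < eps &
     forall k i, i \in Ik k ->
       eps <= lambda i k <= 1 /\ eps <= alpha k <= 2 - eps) ->
  (exists2 s : nat, (1 <= s)%N & intermittent s Ik) ->
  (forall i, boundedly_linearly_regular (T i)) ->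
  bounded_set (range x) ->
  exists k, (C `&` Q) (x k).
Proof.
move=> C [z [Cz Qz]] r_cvg r_decr slow phi_bd [eps eps_gt0 eps_bd] [s _ inter] reg x_bd.
have [rad [rad_gt0 ball_fix]] : exists rad : R, 0 < rad /\
    forall i u, `|u| <= rad -> fix_set (T i) (z + u).
  have /nbhs_ballP[e /= e_gt0 ball_C] : nbhs z C by [].
  exists (e / 2); split; first by rewrite divr_gt0.
  move=> i u u_le; apply: (ball_C (z + u)) => //.
  rewrite -ball_normE /= opprD addNKr normrN (le_lt_trans u_le) //.
  by rewrite ltr_pdivrMr // ltr_pMr // ltr1n.
have mz i : margin dot (T i) rad z.
  exact: (margin_ball norm_dot (T_cutter i) (ltW rad_gt0) (ball_fix i)).
have [B x_le] : exists B : R, forall k, `|x k - z| <= B.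
  case: x_bd => M [_ HM]; exists (M + 1 + `|z|) => k.
  apply: (le_trans (ler_normB _ _)); rewrite lerD2r.
  by apply: (HM (M + 1)); rewrite ?ltrDl //; exists k.
have [delta [Delta [delta_gt0 _ phi_le]]] := phi_bd _ x_bd.
have phi_le' k i : delta <= phi i (x k) <= Delta by apply: phi_le; exists k.
have reg' i : exists c : R, 0 < c /\ forall k,
    c * dist_set (x k) (fix_set (T i)) <= `|T i (x k) - x k|.
  have [_ /(_ (range x))] := reg i.
  case=> [|//|c c_gt0 Hc]; first by exists (x 0%N), 0%N.
  by exists c; split=> // k; apply: Hc; exists k.
have [c c_reg] := choice reg'.
have cV_gt0 i : 0 < (c i)^-1 by rewrite invr_gt0; case: (c_reg i).
(* The sum of the moduli serves as a common modulus of regularity. *)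
pose L := \sum_i (c i)^-1.
have L_ge0 : 0 <= L by apply: sumr_ge0 => i _; exact: ltW.
have L_reg k i : dist_set (x k) (fix_set (T i)) <= L * `|T i (x k) - x k|.
  have [ci_gt0 /(_ k)] := c_reg i; rewrite mulrC -ler_pdivlMr // mulrC => /le_trans.
  apply; rewrite ler_wpM2r // /L (bigD1 i) //= lerDl.
  by apply: sumr_ge0 => j _; exact: ltW.
have x_rec' k : x k.+1 = metric_proj Q (x k + alpha k *:
    \sum_(i in Ik k) lambda i k *: overstep T r phi x k i).
  rewrite x_rec; congr (metric_proj Q (_ + _ *: _)).
  by apply: eq_bigr => i _; rewrite scalerA.
have lambda_ge k i : i \in Ik k -> eps <= lambda i k.
  by move=> /eps_bd[/andP[]].
have alpha_ge k : eps <= alpha k <= 2 - eps.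
  by have /set0Pn[i /eps_bd[]] := Ik_neq0 k.
have [k fix_k] := exists_common_fixed_iterate norm_dot T_cutter Q_closed Q_convex
  r_gt0 r_decr phi_gt0 lambda_sum x0_in x_rec' eps_gt0 lambda_ge alpha_ge
  delta_gt0 phi_le' inter L_ge0 L_reg rad_gt0 Qz mz x_le r_cvg slow.
exists k; split; first by move=> i _; exact: fix_k.
exact: (iterate_in norm_dot Q_closed Q_convex x0_in x_rec' k).
Qed.
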